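(* Let $n,\tilde n,r,\tilde r,d,p$ be natural numbers with $r,\tilde r\ge 1$, $n-r=\tilde n-\tilde r=d$ and $p\le \min\{r,\tilde r\}$. Then there exists a bijection $\Phi:\mathcal{S}_{\le p}(n,r)\to\mathcal{S}_{\le p}(\tilde n,\tilde r)$ that preserves the relation $\preceq$, i.e. for all $\sigma,\sigma'\in\mathcal{S}_{\le p}(n,r)$ we have $\sigma\preceq\sigma'$ if and only if $\Phi(\sigma)\preceq\Phi(\sigma')$.
   Context: For integers $a\le b$, let $[a,b]=\{x\in\mathbb{Z}: a\le x\le b\}$ and $[n]=[1,n]$; $\binom{[n]}{r}$ is the set of $r$-element subsets of $[n]$. For $r\ge1$, an $r$-signotope on $n$ elements is a map $\sigma:\binom{[n]}{r}\to\{+,-\}$ such that for every $(r+1)$-subset $X=\{x_1<\dots<x_{r+1}\}$ of $[n]$, the sequence $(\sigma(X\setminus\{x_1\}),\dots,\sigma(X\setminus\{x_{r+1}\}))$ has at most one sign change. $\mathcal{S}(n,r)$ denotes the set of all $r$-signotopes on $n$ elements, and $\mathcal{S}_{\le p}(n,r)$ the set of those $\sigma$ with $|\sigma^{-1}(+)|\le p$. Two sign functions $\sigma,\tilde\sigma$ differ by a single step if $\sigma^{-1}(+)\subset\tilde\sigma^{-1}(+)$ and $|\tilde\sigma^{-1}(+)|=|\sigma^{-1}(+)|+1$. The higher Bruhat order is the partial order $\preceq$ on $\mathcal{S}(n,r)$ given by the reflexive-transitive closure of the single step relation. *)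

(* Defs.v *)
From HB Require Import structures.
From mathcomp Require Import all_boot.

Set Implicit Arguments.
Unset Strict Implicit.
Unset Printing Implicit Defensive.

(* The ground set [n] = {1 < ... < n} is modelled by 'I_n = {0 < ... < n-1}. *)
Record rsubset (n r : nat) :=
  RSubset { rsubset_val :> {set 'I_n}; _ : #|rsubset_val| == r }.

HB.instance Definition _ n r := [isSub for @rsubset_val n r].
HB.instance Definition _ n r := [Finite of rsubset n r by <:].

(* true stands for the sign +, false for the sign -. *)
Notation sign_function n r := {ffun rsubset n r -> bool}.

Definition plus_set (n r : nat) (s : sign_function n r) : {set rsubset n r} :=
  [set A | s A].

(* The value false is a dummy when #|A| != r; in [is_signotope] below, sign_at
   is only applied to sets with r elements. *)
Definition sign_at (n r : nat) (s : sign_function n r) (A : {set 'I_n}) : bool :=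
  if insub A is Some B then s B else false.

Definition sign_changes (w : seq bool) : nat :=
  if w is a :: w' then count id (pairmap (fun x y => x != y) a w') else 0.

(* [enum X] lists the elements x_1 < ... < x_{r+1} of X in increasing order. *)
Definition is_signotope (n r : nat) (s : sign_function n r) : bool :=
  [forall X : {set 'I_n}, (#|X| == r.+1) ==>
    (sign_changes [seq sign_at s (X :\ x) | x <- enum X] <= 1)].

Record signotope (n r : nat) :=
  Signotope { signs :> sign_function n r; _ : is_signotope signs }.

HB.instance Definition _ n r := [isSub for @signs n r].
HB.instance Definition _ n r := [Finite of signotope n r by <:].

Definition single_step (n r : nat) (s t : sign_function n r) : bool :=
  (plus_set s \subset plus_set t) && (#|plus_set t| == #|plus_set s|.+1).

(* The intermediate elements of a chain of single steps are signotopes: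
   [connect] is taken over the type of signotopes. *)
Definition bruhat_le (n r : nat) : rel (signotope n r) :=
  connect (fun s t : signotope n r => single_step s t).

Record signotope_le (p n r : nat) :=
  SignotopeLe { signotope_le_val :> signotope n r;
                _ : #|plus_set signotope_le_val| <= p }.

HB.instance Definition _ p n r := [isSub for @signotope_le_val p n r].
HB.instance Definition _ p n r := [Finite of signotope_le p n r by <:].

(* Main.v *)
(* Write a set as its increasing sequence of elements and call an (r+1)-set a
   packet, its signs being those of the sets obtained by deleting one element.
   With at most p <= r positive sets no packet is entirely positive, so its
   positive sets form a prefix or a suffix.  Two packets share at most one set,
   hence a longest prefix and a longest suffix have together length at most r+1:
   there is a threshold t in [1, r], common to all packets, such that the
   prefixes live at positions < t and the suffixes at positions >= t.  Doubling
   the t-th smallest element of every positive set then sends S_{<=p}(n, r) to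
   S_{<=p}(n+1, r+1): at every packet a minus sign is inserted between prefix and
   suffix.  The result does not depend on the threshold, so the map preserves and
   reflects inclusion.  Conversely every element of S_{<=p}(n+1, r+1) leaves some
   position t of all packets negative, that is, the t-th and (t+1)-st elements of
   its positive sets are consecutive, and merging them inverts the map. *)

Require Import Defs.
From mathcomp Require Import all_boot zify.

Set Implicit Arguments.
Unset Strict Implicit.
Unset Printing Implicit Defensive.

(** * Increasing lists of naturals: deletion, insertion, doubling, merging *)

Local Notation "s `_ i" := (nth 0 s i) : nat_scope.

(** Untyped lists instead of sets over ['I_n] let [dup] and [con] change [n] and [r] without
    casts. *)
Definition valid (n r : nat) (x : seq nat) : bool :=
  [&& size x == r, sorted ltn x & all (fun y => y < n) x].

Definition del (j : nat) (x : seq nat) : seq nat :=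
  mkseq (fun i => x`_(if i < j then i else i.+1)) (size x).-1.

Definition ins (j y : nat) (x : seq nat) : seq nat :=
  mkseq (fun i => if i < j then x`_i else if i == j then y else x`_i.-1)
    (size x).+1.

(* [dup t x] doubles the [t]-th smallest element [x`_t.-1] of [x], shifting the
   larger ones by one; [con t] undoes this. *)
Definition dup (t : nat) (x : seq nat) : seq nat :=
  mkseq (fun i => if i < t then x`_i else (x`_i.-1).+1) (size x).+1.

Definition con (t : nat) (x : seq nat) : seq nat :=
  mkseq (fun i => if i < t then x`_i else (x`_i.+1).-1) (size x).-1.

Lemma validP n r x :
  reflect [/\ size x = r, forall i, i.+1 < r -> x`_i < x`_i.+1
           & forall i, i < r -> x`_i < n] (valid n r x).
Proof.
apply: (iffP and3P) => [[/eqP<- /(sortedP 0) srt /(all_nthP 0) bnd]|[sz srt bnd]].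
  by split.
by split; [apply/eqP | apply/(sortedP 0); rewrite sz | apply/(all_nthP 0); rewrite sz].
Qed.

Lemma valid_size n r x : valid n r x -> size x = r.
Proof. by case/validP. Qed.

Lemma valid_lt n r x i j : valid n r x -> i < j -> j < r -> x`_i < x`_j.
Proof.
case/validP=> _ srt _; elim: j => // j IH; rewrite ltnS leq_eqVlt => /orP[/eqP->|ij] jr.
  exact: srt.
by apply: ltn_trans (IH ij _) (srt _ jr); apply: ltnW.
Qed.

Lemma valid_ltn n r x i : valid n r x -> i < r -> x`_i < n.
Proof. by case/validP=> _ _; apply. Qed.

Lemma eq_valid n m r x y : valid n r x -> valid m r y ->
  (forall i, i < r -> x`_i = y`_i) -> x = y.
Proof.
move=> /valid_size sx /valid_size sy E.
by apply: (@eq_from_nth _ 0) => [|i]; rewrite sx ?sy //; apply: E.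
Qed.

Lemma nth_del n r x j i : valid n r.+1 x -> i < r ->
  (del j x)`_i = x`_(if i < j then i else i.+1).
Proof. by move=> /valid_size sx ir; rewrite nth_mkseq // sx. Qed.

Lemma nth_ins n r x j y i : valid n r x -> i < r.+1 ->
  (ins j y x)`_i = if i < j then x`_i else if i == j then y else x`_i.-1.
Proof. by move=> /valid_size sx ir; rewrite nth_mkseq // sx. Qed.

Lemma nth_dup n r x t i : valid n r x -> i < r.+1 ->
  (dup t x)`_i = if i < t then x`_i else (x`_i.-1).+1.
Proof. by move=> /valid_size sx ir; rewrite nth_mkseq // sx. Qed.

Lemma nth_con n r x t i : valid n r.+1 x -> i < r ->
  (con t x)`_i = if i < t then x`_i else (x`_i.+1).-1.
Proof. by move=> /valid_size sx ir; rewrite nth_mkseq // sx. Qed.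

Lemma valid_del n r x j : valid n r.+1 x -> valid n r (del j x).
Proof.
move=> vx; apply/validP; split=> [|i ir|i ir].
- by rewrite size_mkseq (valid_size vx).
- rewrite !(nth_del _ vx) //; last exact: ltnW.
  by apply: (valid_lt vx); do 2?case: ifP; lia.
- by rewrite (nth_del _ vx) //; apply: (valid_ltn vx); case: ifP; lia.
Qed.

Lemma valid_ins n r x j y : valid n r x -> j <= r -> y < n ->
  (0 < j -> x`_j.-1 < y) -> (j < r -> y < x`_j) -> valid n r.+1 (ins j y x).
Proof.
move=> vx jr yn lty ltj; apply/validP; split=> [|i ir|i ir].
- by rewrite size_mkseq (valid_size vx).
- rewrite !(nth_ins _ _ vx) //; last exact: ltnW.
  have [ij|ij|E] := ltngtP i j.
  + have [ij'|ij'|ij'] := ltngtP i.+1 j; [|lia|].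
      by apply: (valid_lt vx) => //; lia.
    by move: lty; rewrite -ij'; apply.
  + have [-> ->] : (i.+1 < j) = false /\ (i.+1 == j) = false by lia.
    by apply: (valid_lt vx); lia.
  + rewrite E in ir *.
    have [-> ->] : (j.+1 < j) = false /\ (j.+1 == j) = false by lia.
    by apply: ltj; lia.
- rewrite (nth_ins _ _ vx) //; have [ij|ij|//] := ltngtP i j;
  by apply: (valid_ltn vx); lia.
Qed.

Lemma valid_dup n r x t : 0 < t -> t <= r -> valid n r x ->
  valid n.+1 r.+1 (dup t x).
Proof.
move=> t0 tr vx; apply/validP; split=> [|i ir|i ir].
- by rewrite size_mkseq (valid_size vx).
- rewrite !(nth_dup _ vx) //; last exact: ltnW.
  have [it|it] := ltnP i.+1 t.
    by rewrite (ltnW it); apply: (valid_lt vx) => //; lia.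
  have [it'|it'] := ltnP i t; first exact: ltnSn.
  by rewrite ltnS; apply: (valid_lt vx); lia.
- rewrite (nth_dup _ vx) //; case: (ltnP i t) => it; last first.
    by rewrite ltnS; apply: (valid_ltn vx); lia.
  by rewrite ltnS ltnW //; apply: (valid_ltn vx); lia.
Qed.

Lemma valid_con n r x t : t <= r -> valid n.+1 r.+1 x -> valid n r (con t x).
Proof.
move=> tr vx; apply/validP; split=> [|i ir|i ir].
- by rewrite size_mkseq (valid_size vx).
- rewrite !(nth_con _ vx) //; last exact: ltnW.
  have h1 : x`_i < x`_i.+1 by apply: (valid_lt vx); lia.
  have h2 : x`_i.+1 < x`_i.+2 by apply: (valid_lt vx); lia.
  by do 2?case: ifP; lia.
- rewrite (nth_con _ vx) //.
  have h1 : x`_i < x`_i.+1 by apply: (valid_lt vx); lia.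
  have h2 : x`_i.+1 < n.+1 by apply: (valid_ltn vx); lia.
  by case: ifP; lia.
Qed.

Lemma del_ins n r x j y : valid n r x -> valid n r.+1 (ins j y x) ->
  j <= r -> del j (ins j y x) = x.
Proof.
move=> vx vi jr; apply: (eq_valid (valid_del _ vi) vx) => i ir.
rewrite (nth_del _ vi) // (nth_ins _ _ vx); last by case: ifP; lia.
have [//|ij] := ltnP i j; first by move=> ->.
by rewrite ltnNge (leqW ij) /= gtn_eqF.
Qed.

Lemma dupK n r x t : 0 < t -> t <= r -> valid n r x -> con t (dup t x) = x.
Proof.
move=> t0 tr vx; have vd := valid_dup t0 tr vx.
apply: (eq_valid (valid_con tr vd) vx) => i ir.
rewrite (nth_con _ vd) // !(nth_dup _ vx) //; last exact: ltnW.
by have [//|it] := ltnP i t; rewrite ltnNge (leqW it).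
Qed.

Lemma conK n r x t : 0 < t -> t <= r -> valid n.+1 r.+1 x ->
  x`_t = (x`_t.-1).+1 -> dup t (con t x) = x.
Proof.
move=> t0 tr vx E; have vc := valid_con tr vx.
apply: (eq_valid (valid_dup t0 tr vc) vx) => i ir.
rewrite (nth_dup _ vc) //; case: (ltnP i t) => it.
  by rewrite (nth_con _ vx) ?it //; lia.
rewrite (nth_con _ vx); last by lia.
case: (ltnP i.-1 t) => it'; first by have -> : i = t by lia.
have h : x`_0 < x`_i by apply: (valid_lt vx); lia.
by rewrite (_ : i.-1.+1 = i); lia.
Qed.

Lemma del_inj n r x i j : valid n r.+1 x -> i <= r -> j <= r ->
  del i x = del j x -> i = j.
Proof.
move=> vx; wlog ij : i j / i < j.
  move=> W ir jr E; have [ij|ij|//] := ltngtP i j; first exact: W.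
  by apply/esym/W.
move=> ir jr /(congr1 (fun z => z`_i)); rewrite !(nth_del _ vx); try lia.
rewrite ltnn ij => E.
by have := @valid_lt _ _ _ i i.+1 vx (ltnSn _); rewrite E ltnn; lia.
Qed.

Lemma mem_del n r x i j : valid n r.+1 x -> i <= r -> i != j -> j <= r ->
  x`_i \in del j x.
Proof.
move=> vx ir ij jr; have [lt|gt|E] := ltngtP i j; last by rewrite E eqxx in ij.
  rewrite (_ : x`_i = (del j x)`_i); first by rewrite mem_nth // (valid_size (valid_del _ vx)); lia.
  by rewrite (nth_del _ vx) ?lt //; lia.
rewrite (_ : x`_i = (del j x)`_i.-1); first by rewrite mem_nth // (valid_size (valid_del _ vx)); lia.
by rewrite (nth_del _ vx); [rewrite ltnNge (_ : j <= i.-1) /= ?prednK //; lia|lia].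
Qed.

Lemma sub_del n r x j : valid n r.+1 x -> {subset del j x <= x}.
Proof.
move=> vx y /(nthP 0)[i]; rewrite (valid_size (valid_del _ vx)) => ir <-.
by rewrite (nth_del _ vx) // mem_nth // (valid_size vx); case: ifP; lia.
Qed.

(** An entry of [x] is lost by at most one of the deletions [i] and [j], so it also occurs in [y],
    and conversely. *)
Lemma del2_inj n r x y i i' j j' : valid n r.+1 x -> valid n r.+1 y ->
  i <= r -> j <= r -> i' <= r -> j' <= r ->
  i != j -> del i x = del i' y -> del j x = del j' y -> x = y.
Proof.
move=> vx vy ir jr i'r j'r ij Ei Ej.
have ij' : i' != j'.
  apply: contraNneq ij => E; apply/eqP/(del_inj vx ir jr).
  by rewrite Ei Ej E.
have sub u v k k' l l' : valid n r.+1 u -> valid n r.+1 v -> k <= r -> l <= r ->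
    k != l -> del k u = del k' v -> del l u = del l' v -> {subset u <= v}.
  move=> vu vv kr lr kl Ek El z /(nthP 0)[m]; rewrite (valid_size vu) => mr <-.
  have [E|ne] := eqVneq m k.
    apply: (sub_del (j := l') vv); rewrite -El; apply: mem_del vu _ _ lr => //.
    by rewrite E.
  by apply: (sub_del (j := k') vv); rewrite -Ek; apply: mem_del vu _ _ kr.
have /and3P[_ sx _] := vx; have /and3P[_ sy _] := vy.
apply: (irr_sorted_eq ltn_trans ltnn sx sy) => z; apply/idP/idP.
  exact: (sub x y i i' j j').
by apply: (sub y x i' i j' j).
Qed.

(* [P] is the set of positive [r]-sets; the signs of a packet [x] are the
   booleans [del j x \in P] for [j <= r]. *)
Definition sig (n r : nat) (P : seq (seq nat)) : Prop :=
  forall x, valid n r.+1 x -> forall i j k, i < j -> j < k -> k <= r ->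
  (del i x \in P) = (del k x \in P) -> (del j x \in P) = (del i x \in P).

(** Under [sig] this says that no positive run of a packet crosses the cut between positions [t.-1]
    and [t]. *)
Definition uncrossed (n r t : nat) (P : seq (seq nat)) : Prop :=
  forall x, valid n r.+1 x -> ~~ ((del t.-1 x \in P) && (del t x \in P)).

Definition minus_at (n r t : nat) (P : seq (seq nat)) : Prop :=
  forall x, valid n r.+1 x -> del t x \notin P.

(** * Positive runs in packets and the common threshold *)

Lemma sig_fill n r P x i j k : sig n r P -> valid n r.+1 x ->
  i <= j -> j <= k -> k <= r -> del i x \in P -> del k x \in P -> del j x \in P.
Proof.
move=> sP vx; rewrite leq_eqVlt => /orP[/eqP->//|ij].
rewrite leq_eqVlt => /orP[/eqP->//|jk] kr Pi Pk.
by rewrite (sP x vx i j k) // Pi Pk.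
Qed.

(** The change from minus at [i] to plus at [j] uses up the only sign change. *)
Lemma sig_right n r P x i j k : sig n r P -> valid n r.+1 x ->
  i < j -> j <= k -> k <= r -> del i x \notin P -> del j x \in P -> del k x \in P.
Proof.
move=> sP vx ij; rewrite leq_eqVlt => /orP[/eqP->//|jk] kr Pi Pj.
apply: contraTT Pj => Pk.
by rewrite (sP x vx i j k) // (negbTE Pi) (negbTE Pk).
Qed.

Lemma sig_left n r P x i j k : sig n r P -> valid n r.+1 x ->
  i <= j -> j < k -> k <= r -> del k x \notin P -> del j x \in P -> del i x \in P.
Proof.
move=> sP vx; rewrite leq_eqVlt => /orP[/eqP->//|ij] jk kr Pk Pj.
apply: contraTT Pj => Pi.
by rewrite (sP x vx i j k) // (negbTE Pi) (negbTE Pk).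
Qed.

Lemma uniq_dels n r x m k : valid n r.+1 x -> m + k <= r.+1 ->
  uniq [seq del j x | j <- iota m k].
Proof.
move=> vx mk; rewrite map_inj_in_uniq ?iota_uniq // => i j.
by rewrite !mem_iota => hi hj; apply: (del_inj vx); lia.
Qed.

Lemma dels_le n r (P : seq (seq nat)) x m k : valid n r.+1 x -> m + k <= r.+1 ->
  (forall j, m <= j -> j < m + k -> del j x \in P) -> k <= size P.
Proof.
move=> vx mk inP; rewrite -(size_iota m k) -(size_map (del^~ x)).
apply: uniq_leq_size; first exact: uniq_dels vx mk.
by move=> y /mapP[j]; rewrite mem_iota => /andP[? ?] ->; apply: inP.
Qed.

Lemma size_le1 (T : eqType) (s : seq T) : uniq s ->
  {in s &, forall a b, a = b} -> size s <= 1.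
Proof.
case: s => [|a [|b s]] //= /andP[]; rewrite inE => /norP[/eqP ab _] _ /(_ a b).
by rewrite !inE !eqxx orbT => /(_ isT isT).
Qed.

(** By [del2_inj] the [k] sets of the prefix and the [r.+1 - m] sets of the suffix overlap in at
    most one set, which the bound subtracts. *)
Lemma dels2_le n r (P : seq (seq nat)) x y k m : valid n r.+1 x -> valid n r.+1 y -> x != y ->
  k <= r.+1 -> m <= r ->
  (forall j, j < k -> del j x \in P) ->
  (forall j, m <= j -> j <= r -> del j y \in P) ->
  k + (r - m) <= size P.
Proof.
move=> vx vy xy kr mr Px Py.
pose A := [seq del j x | j <- iota 0 k].
pose B := [seq del j y | j <- iota m (r.+1 - m)].
have uA : uniq A by apply: (uniq_dels vx); lia.
have uB : uniq B by apply: (uniq_dels vy); lia.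
have AB : size [seq z <- B | z \in A] <= 1.
  apply: size_le1 => [|a b]; first exact: filter_uniq.
  rewrite !mem_filter => /andP[/mapP[i]]; rewrite mem_iota => hi ai /mapP[i'].
  rewrite mem_iota => hi' ai' /andP[/mapP[j]]; rewrite mem_iota => hj bj /mapP[j'].
  rewrite mem_iota => hj' bj'; have [ij|ij] := eqVneq i j; first by rewrite ai bj ij.
  case/eqP: xy; apply: (@del2_inj _ r _ _ i i' j j') => //; try lia.
  - by rewrite -ai.
  - by rewrite -bj.
have szB : size [seq z <- B | z \notin A] + size [seq z <- B | z \in A] = r.+1 - m.
  rewrite !size_filter addnC -(size_iota m (r.+1 - m)) -(size_map (del^~ y)).
  exact: count_predC.
have : size (A ++ [seq z <- B | z \notin A]) <= size P.
  apply: uniq_leq_size.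
    rewrite cat_uniq uA filter_uniq // andbT; apply/hasPn => z.
    by rewrite mem_filter => /andP[].
  move=> z; rewrite mem_cat mem_filter => /orP[|/andP[_]] /mapP[j];
    rewrite mem_iota => hj ->; [apply: Px|apply: Py]; lia.
have szA : size A = k by rewrite size_map size_iota.
by rewrite size_cat szA; move: szB AB; set a := size _; set b := size _; lia.
Qed.

(** Finiteness turns the existence of a packet with a given property into a boolean [has], so that
    [threshold] can take a maximum. *)
Lemma valid_enum n r : exists s : seq (seq nat), forall x, valid n r x -> x \in s.
Proof.
exists [seq [seq val i | i <- val y] | y <- enum {: r.-tuple 'I_n}] => x vx.
have bnd i : i \in x -> i < n by case/and3P: vx => _ _ /allP /(_ i).
have sx := valid_size vx.
(* [inord] needs a nonempty ordinal type, so [n = 0], where [x] is empty, is treated apart. *)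
have [n0|n0] := posnP n.
  have x0 : x = [::].
    by case: (x) bnd => // a l /(_ a); rewrite inE eqxx n0 => /(_ isT).
  apply/mapP; have r0 : r = 0 by rewrite -sx x0.
  by move: r0 => ->; exists [tuple]; rewrite ?mem_enum // x0.
case: n n0 bnd {vx} => // n _ bnd.
have sz : size [seq inord i : 'I_n.+1 | i <- x] == r by rewrite size_map sx.
apply/mapP; exists (Tuple sz); first by rewrite mem_enum.
rewrite /= -map_comp -[LHS]map_id; apply/eq_in_map => i ix /=.
by rewrite inordK // bnd.
Qed.

(* [t] is the maximal length of a positive prefix of a packet; the bound on
   positive suffixes comes from two packets sharing at most one set. *)
Lemma threshold n r P : sig n r P -> size P <= r -> exists t,
  [/\ 0 < t, t <= maxn 1 (size P)
   & forall x j, valid n r.+1 x -> j <= r -> del j x \in P ->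
     if del 0 x \in P then j < t else r + t <= j + size P].
Proof.
move=> sP szP; have [s sE] := valid_enum n r.+1.
(* [Q j]: some packet has a positive prefix that reaches position [j]. *)
pose Q j := has (fun x => [&& valid n r.+1 x, j <= r, del 0 x \in P & del j x \in P]) s.
have QP x j : valid n r.+1 x -> j <= r -> del 0 x \in P -> del j x \in P -> Q j.
  by move=> vx jr P0 Pj; apply/hasP; exists x; rewrite ?sE // vx jr P0.
have pre x j : valid n r.+1 x -> j <= r -> del 0 x \in P -> del j x \in P ->
    forall i, i < j.+1 -> del i x \in P.
  by move=> vx jr P0 Pj i ij; apply: (@sig_fill n r P x 0 i j).
have suf x j : valid n r.+1 x -> del 0 x \notin P -> del j x \in P ->
    forall i, j <= i -> i <= r -> del i x \in P.
  move=> vx P0 Pj i ij ir; apply: (@sig_right n r P x 0 j i) => //.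
  by case: j Pj P0 {ij} => // ->.
case: (boolP (has Q (iota 0 r.+1))) => [/hasP[j0 _ Qj0]|/hasPn nQ].
  have bQ j : Q j -> j <= r by case/hasP=> x _ /and4P[].
  case: (ex_maxnP (ex_intro Q j0 Qj0) bQ) => j Qj jmax; exists j.+1.
  case/hasP: Qj => x _ /and4P[vx jr P0 Pj].
  have jP : j.+1 <= size P.
    by apply: (@dels_le n r P x 0) => // i _; apply: pre vx jr P0 Pj i.
  split=> // [|y k vy kr Pk]; first by rewrite leq_max jP orbT.
  case: ifPn => [P0y|P0y]; first by rewrite ltnS; apply: jmax; apply: QP vy _ _ _.
  (* Comparing the longest prefix, of length [j.+1] in [x], with the suffix of [y] from [k] on gives
     [j.+1 + (r - k) <= size P]. *)
  have xy : x != y by apply: contraNneq P0y => <-.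
  have := dels2_le vx vy xy (jr : j.+1 <= r.+1) kr (pre x j vx jr P0 Pj) (suf y k vy P0y Pk).
  by lia.
(* No packet has a positive prefix, so [t = 1] works: a suffix alone has at most [size P] sets. *)
exists 1; split=> // [|y k vy kr Pk]; first by rewrite leq_maxl.
case: ifPn => [P0y|P0y].
  have /nQ : k \in iota 0 r.+1 by rewrite mem_iota; lia.
  by rewrite (QP y).
have : r.+1 - k <= size P.
  apply: (@dels_le n r P y k) => //; first by lia.
  by move=> i ki ik; apply: suf P0y Pk _ ki _ => //; lia.
by lia.
Qed.

(** A plus at [t] is too late for a prefix, and a plus at [t.-1] too early for a suffix because
    [size P <= r]. *)
Lemma exists_uncrossed n r P : 0 < r -> sig n r P -> size P <= r ->
  exists t, [/\ 0 < t, t <= r & uncrossed n r t P].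
Proof.
move=> r0 sP szP; have [t [t0 tP H]] := threshold sP szP.
have tr : t <= r by move: tP; rewrite leq_max; lia.
exists t; split=> // x vx; apply/negP => /andP[P1 P2].
have := H x _ vx _ P1; have := H x _ vx tr P2.
by case: ifP; lia.
Qed.

(** Packets now have [r.+2] sets, so a suffix reaching down to [t] would already force
    [r.+1 <= size P], and a prefix ends before [t]. *)
Lemma exists_minus_at n r P : 0 < r -> sig n r.+1 P -> size P <= r ->
  exists t, [/\ 0 < t, t <= r & minus_at n r.+1 t P].
Proof.
move=> r0 sP szP; have [t [t0 tP H]] := threshold sP (leqW szP).
have tr : t <= r by move: tP; rewrite leq_max; lia.
exists t; split=> // x vx; apply/negP => Pt.
by have := H x _ vx (leqW tr) Pt; case: ifP; lia.
Qed.

(* [lia] case splits on every boolean hypothesis, so the irrelevant ones go. *)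
Ltac nat_lia := repeat match goal with
  | H : is_true (valid _ _ _) |- _ => clear H
  | H : context [in_mem _ _] |- _ => clear H
  end; lia.

Ltac split_ifs := repeat match goal with
  | |- context [if ?b then _ else _] =>
      lazymatch b with
      | context [if _ then _ else _] => fail
      | _ => let H := fresh in destruct b eqn:H; try (exfalso; nat_lia)
      end
  end.

(** The successor of entry [q.-1] fits into the gap and becomes entry [q] of the packet. In
    contrapositive form: a set that is at position [q] of no packet has consecutive entries [q.-1]
    and [q]. *)
Lemma gap_packet n r x q : valid n r x -> 0 < q -> q < r ->
  x`_q != (x`_q.-1).+1 -> exists2 y, valid n r.+1 y & del q y = x.
Proof.
move=> vx q0 qr ne.
have lt1 : x`_q.-1 < x`_q by apply: (valid_lt vx); nat_lia.
have lt2 : x`_q < n by apply: (valid_ltn vx).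
have vi : valid n r.+1 (ins q (x`_q.-1).+1 x) by apply: valid_ins => //; nat_lia.
by exists (ins q (x`_q.-1).+1 x) => //; apply: del_ins vx vi _; nat_lia.
Qed.

(** * Doubling: from rank [r] to rank [r.+1] *)

Section Forward.

Variables (n r t : nat) (P : seq (seq nat)).
Hypotheses (t0 : 0 < t) (tr : t <= r).
Hypotheses (vP : {in P, forall x, valid n r x}).

Lemma mem_map_dup c : valid n.+1 r.+1 c ->
  (c \in map (dup t) P) = (c`_t == (c`_t.-1).+1) && (con t c \in P).
Proof.
move=> vc; apply/mapP/andP => [[a aP ->]|[/eqP E cP]].
  have va := vP aP; rewrite (dupK t0 tr va) aP !(nth_dup _ va); try nat_lia.
  by rewrite ltnn (_ : t.-1 < t) //; nat_lia.
by exists (con t c); rewrite ?(conK t0 tr vc E).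
Qed.

(** Deleting entry [t] brings the non-consecutive entries [t.-1] and [t.+1] together, whereas a
    doubled set has consecutive entries at [t.-1] and [t]. *)
Lemma dup_minus_at : minus_at n.+1 r.+1 t (map (dup t) P).
Proof.
move=> x vx; rewrite mem_map_dup; last exact: valid_del.
rewrite !(nth_del _ vx) ?ltnn; try nat_lia.
rewrite (_ : t.-1 < t); last by nat_lia.
have lt1 : x`_t.-1 < x`_t by apply: (valid_lt vx); nat_lia.
have lt2 : x`_t < x`_t.+1 by apply: (valid_lt vx); nat_lia.
by apply/negP => /andP[/eqP E _]; nat_lia.
Qed.

(** With [dup_minus_at] and [dup_del_gt]: the signs of [x] are those of [con t x] with a minus
    inserted at [t], except that a gap just above entry [t] blanks all positions below [t], and a
    gap just below it those above [t]. *)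
Lemma dup_del_lt x j : valid n.+1 r.+2 x -> j < t ->
  (del j x \in map (dup t) P) = (x`_t.+1 == (x`_t).+1) && (del j (con t x) \in P).
Proof.
move=> vx jt; have vc : valid n r.+1 (con t x) by apply: valid_con vx; nat_lia.
rewrite mem_map_dup; last exact: valid_del.
rewrite !(nth_del _ vx); try nat_lia.
rewrite (_ : (t < j) = false); last by nat_lia.
rewrite (_ : (t.-1 < j) = false) ?prednK //; last by nat_lia.
case: eqP => //= E; congr (_ \in P).
apply: (eq_valid (valid_con tr (valid_del j vx)) (valid_del j vc)) => i ir.
rewrite (nth_con _ (valid_del j vx)) // (nth_del _ vc) // !(nth_del _ vx); try nat_lia.
rewrite (nth_con _ vx); last by case: ifP; nat_lia.
split_ifs; try by [].
(* The one index where consecutiveness is needed: the left side keeps entry [t] of [x], the right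
   side entry [t.+1] minus one. *)
have -> : i = t.-1 by nat_lia.
by rewrite prednK // E.
Qed.

Lemma dup_del_gt x j : valid n.+1 r.+2 x -> t < j -> j <= r.+1 ->
  (del j x \in map (dup t) P) =
  (x`_t == (x`_t.-1).+1) && (del j.-1 (con t x) \in P).
Proof.
move=> vx tj jr; have vc : valid n r.+1 (con t x) by apply: valid_con vx; nat_lia.
rewrite mem_map_dup; last exact: valid_del.
rewrite !(nth_del _ vx); try nat_lia.
rewrite tj (_ : (t.-1 < j)); last by nat_lia.
congr (_ && (_ \in P)).
apply: (eq_valid (valid_con tr (valid_del j vx)) (valid_del j.-1 vc)) => i ir.
rewrite (nth_con _ (valid_del j vx)) // (nth_del _ vc) // !(nth_del _ vx); try nat_lia.
rewrite (nth_con _ vx); last by case: ifP; nat_lia.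
by split_ifs.
Qed.

(** The positive positions of [con t x] do not cross the cut at [t], so they form a prefix before
    [t] or a suffix from [t] on: the inserted minus does not split them, and blanking a side keeps
    or erases them all. *)
Lemma sig_dup : sig n r P -> uncrossed n r t P -> sig n.+1 r.+1 (map (dup t) P).
Proof.
move=> sP gP x vx i j k ij jk kr.
have vc : valid n r.+1 (con t x) by apply: valid_con vx; nat_lia.
have := gP _ vc; set y := con t x => gy.
have nx := negbTE (dup_minus_at vx).
have [it|it] := ltnP i t.
  have cross l m : l < t -> t <= m -> m <= r -> del l y \in P -> del m y \in P -> False.
    move=> lt tm mr Pl Pm; case/negP: gy; apply/andP; split;
      by apply: (@sig_fill n r P y l _ m) => //; nat_lia.
  have [jt|jt|jE] := ltngtP j t.
  - have [kt|kt|->] := ltngtP k t.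
    + by rewrite !dup_del_lt //; case: eqP => //= _; apply: (sP y vc i j k); nat_lia.
    + rewrite (dup_del_gt vx kt kr) !dup_del_lt //.
      case: eqP => //= _; case: eqP => _ /=.
        rewrite -/y => E; apply: (sP y vc i j k.-1) => //; nat_lia.
      (* The side above [t] is blank here; a plus at [j] after the minus at [i] would run on across
         the cut. *)
      rewrite -/y => Pi; rewrite Pi; apply/negP => Pj.
      case/negP: gy; apply/andP; split;
      by apply: (@sig_right n r P y i j) => //; rewrite ?Pi //; nat_lia.
    + rewrite nx !dup_del_lt //; case: eqP => //= _; rewrite -/y => Pi.
      rewrite Pi; apply/negP => Pj.
      case/negP: gy; apply/andP; split;
      by apply: (@sig_right n r P y i j) => //; rewrite ?Pi //; nat_lia.
  - have kt : t < k by nat_lia.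
    rewrite (dup_del_gt vx kt kr) dup_del_lt // (dup_del_gt vx jt) -/y; last by nat_lia.
    case: (x`_t.+1 == _) => /=; case: (x`_t == _) => //=.
      move=> E; have [Pi|Pi] := boolP (del i y \in P).
        by case: (cross i k.-1) => //; rewrite -?E //; nat_lia.
      rewrite (sP y vc i j.-1 k.-1 _ _ _ E) ?(negbTE Pi) //; nat_lia.
    move=> /esym Pk; apply/negP => Pj.
    case/negP: gy; apply/andP; split;
      by apply: (@sig_left n r P y _ j.-1 k.-1) => //; rewrite ?Pk //; nat_lia.
  - have kt : t < k by nat_lia.
    rewrite jE nx (dup_del_gt vx kt kr) dup_del_lt // -/y => E.
    apply/esym/negP => Pi; move: E; rewrite Pi => /esym/andP[_ Pk].
    by case/andP: Pi => _ Pi; apply: (cross i k.-1) => //; nat_lia.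
have [jt kt] : t < j /\ t < k by nat_lia.
rewrite (dup_del_gt vx kt kr) (dup_del_gt vx jt) -/y; last by nat_lia.
have [E|ne] := eqVneq i t.
  rewrite E nx => /esym/negbT; rewrite negb_and; case: eqP => //= _ Pk.
  apply/negP => Pj.
  case/negP: gy; apply/andP; split;
    by apply: (@sig_left n r P y _ j.-1 k.-1) => //; nat_lia.
have {it ne} it : t < i by nat_lia.
rewrite (dup_del_gt vx it) -/y; last by nat_lia.
case: eqP => //= _; apply: (sP y vc) => //; nat_lia.
Qed.

End Forward.

(** * Merging: from rank [r.+1] back to rank [r] *)

Section Backward.

Variables (n r t : nat) (P : seq (seq nat)).
Hypotheses (t0 : 0 < t) (tr : t <= r) (szP : size P <= r).
Hypotheses (vP : {in P, forall x, valid n.+1 r.+1 x}).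
Hypotheses (sP : sig n.+1 r.+1 P) (gP : minus_at n.+1 r.+1 t P).

(** A gap between entries [t.-1] and [t] of a positive set would put it at position [t] of some
    packet, where the sign is minus. *)
Lemma minus_at_conK : {in P, cancel (con t) (dup t)}.
Proof.
move=> x xP; have vx := vP xP; apply: (conK t0 tr vx); apply/eqP; apply: contraT => ne.
have [y vy yx] := gap_packet vx t0 (leq_ltn_trans tr (ltnSn r)) ne.
by have := gP vy; rewrite yx xP.
Qed.

Lemma mem_map_con a : valid n r a -> (a \in map (con t) P) = (dup t a \in P).
Proof.
move=> va; apply/mapP/idP => [[c cP ->]|aP]; first by rewrite minus_at_conK.
by exists (dup t a); rewrite // (dupK t0 tr va).
Qed.

(** For [j < t] the [t]-th smallest element of [del j y] is the [t.+1]-st of [y]; for [j >= t] it is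
    the [t]-th. So the two sides of [y] are read in two packets, [dup t.+1 y] here and [dup t y] in
    [con_del_ge]. *)
Lemma con_del_lt y j : valid n r.+1 y -> j < t ->
  (del j y \in map (con t) P) = (del j (dup t.+1 y) \in P).
Proof.
move=> vy jt; have vd : valid n.+1 r.+2 (dup t.+1 y) by apply: valid_dup vy; nat_lia.
rewrite mem_map_con; last exact: valid_del.
congr (_ \in P).
apply: (eq_valid (valid_dup t0 tr (valid_del j vy)) (valid_del j vd)) => i ir.
rewrite (nth_dup _ (valid_del j vy)) // (nth_del _ vd) // (nth_dup _ vy); last by case: ifP; nat_lia.
case: (ltnP i r) => ir'; last first.
  rewrite (_ : (i < t) = false); last by nat_lia.
  rewrite !(nth_del _ vy); last by nat_lia.
  split_ifs.
  by rewrite prednK //; nat_lia.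
rewrite !(nth_del _ vy); try nat_lia.
split_ifs; try by [].
by rewrite prednK //; nat_lia.
Qed.

Lemma con_del_ge y j : valid n r.+1 y -> t <= j -> j <= r ->
  (del j y \in map (con t) P) = (del j.+1 (dup t y) \in P).
Proof.
move=> vy tj jr; have vd : valid n.+1 r.+2 (dup t y) by apply: valid_dup vy; nat_lia.
rewrite mem_map_con; last exact: valid_del.
congr (_ \in P).
apply: (eq_valid (valid_dup t0 tr (valid_del j vy)) (valid_del j.+1 vd)) => i ir.
rewrite (nth_dup _ (valid_del j vy)) // (nth_del _ vd) // (nth_dup _ vy); last by case: ifP; nat_lia.
have [it|it] := ltnP i t.
  rewrite (nth_del _ vy); last by nat_lia.
  by split_ifs.
rewrite (nth_del _ vy); last by nat_lia.
split_ifs; try by [].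
by rewrite prednK //; nat_lia.
Qed.

(* If the middle of [y] has a gap, filling it in [dup t (del 0 y)] and in
   [dup t (del r y)] gives two packets with a positive prefix of length [t] and a
   positive suffix of length [r.+1 - t]; only the sets of the former contain the
   successor of the maximum of [y]. *)
Lemma con_not_both y i k : valid n r.+1 y -> i < t -> t <= k -> k <= r ->
  del i y \in map (con t) P -> del k y \in map (con t) P -> False.
Proof.
move=> vy it tk kr Pi Pk.
have v1 : valid n.+1 r.+2 (dup t y) by apply: valid_dup vy; nat_lia.
have v2 : valid n.+1 r.+2 (dup t.+1 y) by apply: valid_dup vy; nat_lia.
(* Position [t] is negative in both doubled packets, so the plus at [i] extends down to [0] and the
   one at [k] up to the end. *)
have {Pi} P0 : del 0 y \in map (con t) P.
  move: Pi; rewrite !con_del_lt // => Pi.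
  by apply: (@sig_left _ _ P _ 0 i t sP v2) => //; [nat_lia|apply: gP].
have {Pk} Pr : del r y \in map (con t) P.
  move: Pk; rewrite !con_del_ge // => Pk.
  by apply: (@sig_right _ _ P _ t k.+1 r.+1 sP v1) => //; apply: gP.
(* If entries [t.-1] and [t] of [y] are consecutive, the two doubled packets coincide, and position
   [t] would be filled. *)
have [E|ne] := eqVneq y`_t (y`_t.-1).+1.
  have E12 : dup t y = dup t.+1 y.
    apply: (eq_valid v1 v2) => l lr; rewrite !(nth_dup _ vy) //.
    split_ifs; try by [].
    by have -> : l = t by nat_lia.
  move: P0 Pr; rewrite con_del_lt // con_del_ge // E12 => P0 Pr.
  by have /negP := gP v2; apply; apply: (sig_fill sP v2 _ _ _ P0 Pr); nat_lia.
have vd0 := valid_del 0 vy; have vdr := valid_del r vy.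
move: P0 Pr; rewrite !mem_map_con //.
set c := dup t (del 0 y); set c' := dup t (del r y) => P0 Pr.
have vc : valid n.+1 r.+1 c by apply: valid_dup.
have vc' : valid n.+1 r.+1 c' by apply: valid_dup.
have lt1 : y`_t.-1 < y`_t by apply: (valid_lt vy); nat_lia.
have ltn1 : y`_t < n by apply: (valid_ltn vy); nat_lia.
(* Up to position [t.-1], [c] is [y] without its first entry; the successor of entry [t.-1] of [y]
   thus fits just before entry [t]. *)
have vz : valid n.+1 r.+2 (ins t.-1 (y`_t.-1).+1 c).
  apply: valid_ins => //; try nat_lia.
    move=> t1; rewrite (nth_dup _ vd0) ?(nth_del _ vy); try nat_lia.
    by split_ifs; rewrite ?prednK //=; nat_lia.
  move=> _; rewrite (nth_dup _ vd0) ?(nth_del _ vy); try nat_lia.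
  by split_ifs; rewrite prednK //; nat_lia.
(* In [c'] the ends of the gap are raised by one and sit at positions [t] and [t.+1], the upper one
   only if [t < r]; entry [t] of [y] fits in. *)
have vz' : valid n.+1 r.+2 (ins t.+1 y`_t c').
  apply: valid_ins => //; try nat_lia.
    move=> _ /=; rewrite (nth_dup _ vdr) // ltnn (nth_del _ vy); last nat_lia.
    by split_ifs; rewrite /=; nat_lia.
  move=> tr'; rewrite (nth_dup _ vdr) // (ltnNge t.+1 t) (leqnSn t) /= (nth_del _ vy) //.
  by split_ifs; rewrite /=; nat_lia.
set z := ins _ _ _ in vz; set z' := ins _ _ _ in vz'.
have Pz l : l < t -> del l z \in P.
  move=> lt; apply: (@sig_left _ _ P z l t.-1 t sP vz); try nat_lia; first exact: gP.
  by rewrite (del_ins vc vz) //; nat_lia.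
have Pz' l : t < l -> l <= r.+1 -> del l z' \in P.
  move=> tl lr; apply: (@sig_right _ _ P z' t t.+1 l sP vz') => //; first exact: gP.
  by rewrite (del_ins vc' vz').
have top l : l < t -> (del l z)`_r = (y`_r).+1.
  move=> lt; rewrite (nth_del _ vz) //.
  rewrite (_ : (r < l) = false); last by nat_lia.
  rewrite (nth_ins _ _ vc) //.
  have [-> ->] : (r.+1 < t.-1) = false /\ (r.+1 == t.-1) = false by nat_lia.
  rewrite (nth_dup _ vd0) //= ltnNge tr /= (nth_del _ vy); last by nat_lia.
  by rewrite ltn0 prednK //; nat_lia.
have top' l : t < l -> l <= r.+1 -> (del l z')`_r <= y`_r.
  move=> tl lr; rewrite (nth_del _ vz') //.
  (* The last entry of [z'] is the inserted one if [t = r], and otherwise the successor of entry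
     [r.-1] of [y]. *)
  have zr : z'`_r.+1 <= y`_r.
    rewrite (nth_ins _ _ vc') // ltnS (ltnNge r) tr /=.
    case: eqP => [[<-]//|ne']; rewrite (nth_dup _ vdr) // ltnNge tr /= (nth_del _ vy); last by nat_lia.
    rewrite (_ : r.-1 < r); last by nat_lia.
    by apply: (valid_lt vy); nat_lia.
  case: ifP => // _; apply: leq_trans zr; apply: ltnW.
  exact: (valid_lt vz').
have : size ([seq del l z | l <- iota 0 t] ++ [seq del l z' | l <- iota t.+1 (r.+1 - t)])
    <= size P.
  apply: uniq_leq_size.
    rewrite cat_uniq (uniq_dels vz) ?(uniq_dels vz') ?andbT /=; try nat_lia.
    apply/hasPn => u /mapP[l]; rewrite mem_iota => hl ->.
    apply/negP => /mapP[l']; rewrite mem_iota => hl' /(congr1 (fun v => v`_r)).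
    rewrite top; last by nat_lia.
    by move=> E; have := top' l; rewrite E ltnn; nat_lia.
  by move=> u; rewrite mem_cat => /orP[] /mapP[l]; rewrite mem_iota => hl ->;
    [apply: Pz|apply: Pz']; nat_lia.
by rewrite size_cat !size_map !size_iota; nat_lia.
Qed.

Lemma con_uncrossed : uncrossed n r t (map (con t) P).
Proof.
move=> y vy; apply/negP => /andP[P1 P2].
by apply: (con_not_both vy _ (leqnn t) tr P1 P2); nat_lia.
Qed.

(** Indices on one side of [t] are read in a single doubled packet. If [i < t <= k], equal signs are
    minus by [con_not_both], and the minus at [t] in the packet where [j] is read replaces the
    endpoint on the other side. *)
Lemma sig_con : sig n r (map (con t) P).
Proof.
move=> y vy i j k ij jk kr.
have v1 : valid n.+1 r.+2 (dup t y) by apply: valid_dup vy; nat_lia.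
have v2 : valid n.+1 r.+2 (dup t.+1 y) by apply: valid_dup vy; nat_lia.
have g1 := negbTE (gP v1); have g2 := negbTE (gP v2).
have [it|it] := ltnP i t; last first.
  by rewrite !(con_del_ge vy); try nat_lia; apply: (sP v1); nat_lia.
have [kt|kt] := ltnP k t.
  by rewrite !(con_del_lt vy); try nat_lia; apply: (sP v2); nat_lia.
have [Pi|Pi] := boolP (del i y \in _).
  by move=> /esym Pk; case: (con_not_both vy it kt kr Pi Pk).
move=> /esym Pk; have [jt|jt] := ltnP j t.
  rewrite con_del_lt // (sP v2 ij jt); [|nat_lia|]; rewrite ?g2 -(con_del_lt vy it) (negbTE Pi) //.
rewrite con_del_ge //; last by nat_lia.
rewrite (sP v1 (i := t) (k := k.+1)) ?g1 //.
by rewrite -con_del_ge // Pk.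
Qed.

End Backward.

(** A gap between entries [q.-1] and [q] of [a], for [t <= q < u], would put [a] at position [q] of
    a packet. Enclosed by two uncrossed cuts, this plus forces minus at [t.-1] and at [u]: two sign
    changes. So these entries are consecutive, and doubling at either cut gives the same set. *)
Lemma uncrossed_dup_eq n r t u P a : sig n r P -> uncrossed n r t P -> uncrossed n r u P ->
  0 < t -> t <= r -> 0 < u -> u <= r -> valid n r a -> a \in P -> dup t a = dup u a.
Proof.
move=> sP; wlog tu : t u / t < u.
  move=> W gt gu t0 tr u0 ur va aP; have [lt|lt|->//] := ltngtP t u; first exact: W.
  by apply/esym/W.
move=> gt gu t0 tr u0 ur va aP.
have step q : t <= q -> q < u -> a`_q = (a`_q.-1).+1.
  move=> tq qu; apply/eqP; apply: contraT => ne.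
  have [||x vx xa] := gap_packet va _ _ ne; try nat_lia.
  move: aP; rewrite -xa => Pq.
  have nt : del t.-1 x \notin P.
    apply: contra (gt x vx) => Pt; rewrite Pt.
    by apply: (sig_fill sP vx _ _ _ Pt Pq); nat_lia.
  have nu : del u x \notin P.
    apply: contra (gu x vx) => Pu; rewrite Pu andbT.
    by apply: (sig_fill sP vx _ _ _ Pq Pu); nat_lia.
  by case/negP: nu; apply: (sig_right sP vx _ _ _ nt Pq); nat_lia.
apply: (eq_valid (valid_dup t0 tr va) (valid_dup u0 ur va)) => i ir.
rewrite !(nth_dup _ va) //; split_ifs; try by [].
by rewrite (step i) //; nat_lia.
Qed.

(** As for doubling: a plus at [q] with [t < q <= u], after the minus at [t], would run on to
    [u]. *)
Lemma minus_at_con_eq n r t u P c : sig n.+1 r.+1 P -> minus_at n.+1 r.+1 t P ->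
  minus_at n.+1 r.+1 u P ->
  t <= r -> u <= r -> valid n.+1 r.+1 c -> c \in P -> con t c = con u c.
Proof.
move=> sP; wlog tu : t u / t < u.
  move=> W gt gu tr ur vc cP; have [lt|lt|->//] := ltngtP t u; first exact: W.
  by apply/esym/W.
move=> gt gu tr ur vc cP.
have step q : t < q -> q <= u -> c`_q = (c`_q.-1).+1.
  move=> tq qu; apply/eqP; apply: contraT => ne.
  have [||x vx xa] := gap_packet vc _ _ ne; try nat_lia.
  move: cP; rewrite -xa => Pq.
  have /negP := gu x vx; case.
  by apply: (sig_right sP vx _ _ _ (gt x vx) Pq); nat_lia.
apply: (eq_valid (valid_con tr vc) (valid_con ur vc)) => i ir.
rewrite !(nth_con _ vc) //; split_ifs; try by [].
by rewrite (step i.+1) //; nat_lia.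
Qed.

(** * Sign changes, and signotopes in terms of lists *)

Lemma sign_changes_cons (a b : bool) w :
  sign_changes [:: a, b & w] = (a != b) + sign_changes (b :: w).
Proof. by []. Qed.

Lemma sign_changes_eq0 (b : bool) w :
  (sign_changes (b :: w) == 0) <-> (forall i, i < size w -> nth false w i = b).
Proof.
elim: w b => [//|c w IH] b; rewrite sign_changes_cons addn_eq0 eqb0 negbK; split.
  by case/andP=> /eqP-> /IH wc [|i] //; apply: wc.
move=> H; have /= cb := H 0 isT; rewrite cb eqxx; apply/IH => i iw.
exact: (H i.+1 iw).
Qed.

(** With two signs, a second change returns to the earlier sign; once the first two signs differ,
    the rest has to be constant. *)
Lemma sign_changes_le1 w : (sign_changes w <= 1) <->
  (forall i j k, i < j -> j < k -> k < size w ->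
     nth false w i = nth false w k -> nth false w j = nth false w i).
Proof.
case: w => [|a w]; first by split=> // _ i j [].
elim: w a => [|b w IH] a; first by split=> // _ i [|j] [|k].
rewrite sign_changes_cons; have [ab|ab] := eqVneq a b.
  rewrite add0n; split=> [/IH H|H].
    case=> [|i] [|j] [|k] //= ij jk kw; last exact: (H i j k).
    case: j ij jk => [|j] _ jk; first by rewrite ab.
    by rewrite ab; apply: (H 0 j.+1 k).
  by apply/IH => i j k ij jk kw; apply: (H i.+1 j.+1 k.+1).
rewrite addSn ltnS add0n leqn0 sign_changes_eq0; split=> [H|H i iw].
  case=> [|i] [|[|j]] [|[|k]] //= ij jk kw.
  - by rewrite (H k) // => E; rewrite E eqxx in ab.
  - by rewrite (H k) // (H j) //; lia.
  - by rewrite (H k) // (H j) //; lia.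
(* An entry different from [b] would equal [a], so that [a] would recur after [b]. *)
have /= := H 0 1 i.+2 isT isT iw.
by move: ab; case: a b (nth _ _ _) {H IH} => [] [] [] // _ /(_ erefl).
Qed.

Definition to_seq (n : nat) (A : {set 'I_n}) : seq nat := [seq val x | x <- enum A].

Lemma mem_to_seq n (A : {set 'I_n}) (x : 'I_n) : (val x \in to_seq A) = (x \in A).
Proof. by rewrite mem_map ?mem_enum //; apply: val_inj. Qed.

Lemma to_seq_inj n : injective (@to_seq n).
Proof. by move=> A B E; apply/setP => x; rewrite -!mem_to_seq E. Qed.

Lemma valid_to_seq n (A : {set 'I_n}) : valid n #|A| (to_seq A).
Proof.
apply/and3P; split; first by rewrite size_map -cardE.
  rewrite sorted_map /enum_mem; apply: sorted_filter; first by move=> ? ? ?; apply: ltn_trans.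
  by rewrite -enumT -sorted_map val_enum_ord iota_ltn_sorted.
by apply/allP => y /mapP[x _ ->]; apply: ltn_ord.
Qed.

Lemma valid_rsubset n r (A : rsubset n r) : valid n r (to_seq A).
Proof. by have := valid_to_seq A; rewrite (eqP (valP A)). Qed.

Lemma valid_to_seqP n r x : valid n r x -> exists A : rsubset n r, to_seq A = x.
Proof.
move=> vx; pose A := [set i : 'I_n | val i \in x].
have E : to_seq A = x.
  have /and3P[_ sx /allP bx] := vx; have /and3P[_ sA _] := valid_to_seq A.
  apply: (irr_sorted_eq ltn_trans ltnn sA sx) => y; apply/idP/idP => [/mapP[i]|yx].
    by rewrite mem_enum inE => ix ->.
  have -> : y = val (Ordinal (bx y yx)) by [].
  by rewrite mem_to_seq inE.
have cA : #|A| == r by rewrite cardE -(size_map val) -/(to_seq A) E (valid_size vx).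
by exists (RSubset cA).
Qed.

Lemma to_seqD1 n r (X : {set 'I_n}) x0 j : #|X| = r.+1 -> j <= r ->
  to_seq (X :\ nth x0 (enum X) j) = del j (to_seq X).
Proof.
move=> cX jr; have vX := valid_to_seq X; rewrite cX in vX.
have sX : size (enum X) = r.+1 by rewrite -cardE.
have /and3P[_ s1 _] := valid_to_seq (X :\ nth x0 (enum X) j).
have /and3P[_ s2 _] := valid_del j vX.
have nX i : i <= r -> (to_seq X)`_i = val (nth x0 (enum X) i).
  by move=> ir; rewrite (nth_map x0) // sX.
apply: (irr_sorted_eq ltn_trans ltnn s1 s2) => y; apply/idP/idP.
  case/mapP=> x; rewrite mem_enum !inE => /andP[xj xX] ->.
  move: xX; rewrite -mem_enum => /(nthP x0)[i]; rewrite sX => ir Ei.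
  rewrite -Ei -nX //; apply: mem_del vX _ _ jr => //.
  by apply: contraNneq xj => <-; rewrite Ei.
case/(nthP 0)=> i; rewrite (valid_size (valid_del j vX)) => ir <-.
rewrite (nth_del _ vX) // nX; last by case: ifP; lia.
rewrite mem_to_seq !inE -mem_enum mem_nth ?sX ?andbT; last by case: ifP; lia.
by rewrite nth_uniq ?enum_uniq ?sX //; case: ifP; lia.
Qed.

Definition plus_seqs n r (s : sign_function n r) : seq (seq nat) :=
  [seq to_seq (val A) | A <- enum (plus_set s)].

Lemma to_seq_val_inj n r : injective (fun A : rsubset n r => to_seq (val A)).
Proof. by move=> A B /to_seq_inj/val_inj. Qed.

Lemma size_plus_seqs n r (s : sign_function n r) : size (plus_seqs s) = #|plus_set s|.
Proof. by rewrite size_map -cardE. Qed.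

Lemma plus_seqs_uniq n r (s : sign_function n r) : uniq (plus_seqs s).
Proof. by rewrite map_inj_uniq ?enum_uniq //; apply: to_seq_val_inj. Qed.

Lemma mem_plus_seqs n r (s : sign_function n r) (A : rsubset n r) :
  (to_seq A \in plus_seqs s) = s A.
Proof. by rewrite (mem_map (@to_seq_val_inj n r)) mem_enum inE. Qed.

Lemma valid_plus_seqs n r (s : sign_function n r) :
  {in plus_seqs s, forall x, valid n r x}.
Proof. by move=> x /mapP[A _ ->]; apply: valid_rsubset. Qed.

Lemma sign_at_plus n r (s : sign_function n r) (A : {set 'I_n}) :
  #|A| = r -> sign_at s A = (to_seq A \in plus_seqs s).
Proof.
move=> cA; have cA' : #|A| == r by apply/eqP.
by rewrite /sign_at (insubT (fun B : {set 'I_n} => #|B| == r) cA') -mem_plus_seqs.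
Qed.

Lemma signotopeP n r (s : sign_function n r) :
  is_signotope s <-> sig n r (plus_seqs s).
Proof.
have nthE (X : {set 'I_n}) j : #|X| = r.+1 -> j <= r ->
    nth false [seq sign_at s (X :\ x) | x <- enum X] j
    = (del j (to_seq X) \in plus_seqs s).
  move=> cX jr; have [x0 _] : exists x0, x0 \in X.
    by apply/set0Pn; rewrite -card_gt0 cX.
  have sX : j < size (enum X) by rewrite -cardE cX.
  rewrite (nth_map x0) // sign_at_plus ?(to_seqD1 _ cX) //.
  have xX : nth x0 (enum X) j \in X by rewrite -mem_enum mem_nth.
  by move: (cardsD1 (nth x0 (enum X) j) X); rewrite xX cX => -[].
split=> [/forallP H x vx i j k ij jk kr|H].
  have [X EX] := valid_to_seqP vx; have cX := eqP (valP X).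
  have /sign_changes_le1 := implyP (H X) (valP X).
  rewrite size_map -cardE cX => /(_ i j k ij jk kr).
  by rewrite !nthE ?EX //; lia.
apply/forallP => X; apply/implyP => /eqP cX; apply/sign_changes_le1 => i j k ij jk.
rewrite size_map -cardE cX => kr; rewrite !nthE //; try lia.
by apply: H => //; rewrite -cX; apply: valid_to_seq.
Qed.

Lemma sig_eq n r P Q : P =i Q -> sig n r P -> sig n r Q.
Proof. by move=> E sP x vx i j k; rewrite -!E; apply: sP. Qed.

Lemma sig_signotope n r P : {in P, forall x, valid n r x} -> sig n r P ->
  exists s : signotope n r, plus_seqs s =i P.
Proof.
move=> vP sP; pose s : sign_function n r := [ffun A : rsubset n r => to_seq A \in P].
have E : plus_seqs s =i P.
  move=> x; apply/idP/idP => [|xP]; last first.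
    have [A EA] := valid_to_seqP (vP x xP).
    by rewrite -EA mem_plus_seqs ffunE EA.
  by case/mapP=> A; rewrite mem_enum inE ffunE => AP ->.
have sigS : is_signotope s.
  by apply/signotopeP; apply: sig_eq sP => x; rewrite E.
by exists (Signotope sigS).
Qed.

Lemma plus_set_sub n r (s u : sign_function n r) :
  (plus_set s \subset plus_set u) <-> {subset plus_seqs s <= plus_seqs u}.
Proof.
split=> [/subsetP H x /mapP[A]|H].
  by rewrite mem_enum => /H As ->; rewrite mem_plus_seqs; rewrite inE in As.
by apply/subsetP => A; rewrite !inE -!mem_plus_seqs; apply: H.
Qed.

Lemma plus_set_inj n r : injective (@plus_set n r).
Proof. by move=> s u /setP E; apply/ffunP => A; have := E A; rewrite !inE. Qed.

(** A relation with [t] quantified inside: no canonical threshold has to be chosen, as the result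
    does not depend on it. *)
Definition dup_rel p n r (s : signotope_le p n r) (s' : signotope_le p n.+1 r.+1) :
    Prop :=
  exists t, [/\ 0 < t, t <= r, uncrossed n r t (plus_seqs s)
    & plus_seqs s' =i map (dup t) (plus_seqs s)].

(** * Doubling as an inclusion-preserving bijection *)

Section DupRel.

Variables (p n r : nat).
Hypotheses (r0 : 0 < r) (pr : p <= r).
Implicit Types (s u : signotope_le p n r) (v w : signotope_le p n.+1 r.+1).

Lemma dup_relT s : exists v, dup_rel s v.
Proof.
have sS : sig n r (plus_seqs s) by apply/signotopeP/valP.
have szS : size (plus_seqs s) <= p by rewrite size_plus_seqs; apply: (valP s).
have [t [t0 tr gt]] := exists_uncrossed r0 sS (leq_trans szS pr).
have vS := @valid_plus_seqs n r s.
have vS' : {in map (dup t) (plus_seqs s), forall x, valid n.+1 r.+1 x}.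
  by move=> x /mapP[a /vS va ->]; apply: valid_dup.
have [v Ev] := sig_signotope vS' (sig_dup t0 tr vS sS gt).
have le' : #|plus_set v| <= p.
  rewrite -size_plus_seqs; apply: leq_trans szS; rewrite -(size_map (dup t) (plus_seqs s)).
  by apply: uniq_leq_size (plus_seqs_uniq v) _ => x; rewrite Ev.
by exists (SignotopeLe le'), t.
Qed.

Lemma dup_rel_onto v : exists s, dup_rel s v.
Proof.
have sS : sig n.+1 r.+1 (plus_seqs v) by apply/signotopeP/valP.
have szS : size (plus_seqs v) <= p by rewrite size_plus_seqs; apply: (valP v).
have [t [t0 tr gt]] := exists_minus_at r0 sS (leq_trans szS pr).
have vS := @valid_plus_seqs n.+1 r.+1 v.
have vS' : {in map (con t) (plus_seqs v), forall x, valid n r x}.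
  by move=> x /mapP[a /vS va ->]; apply: valid_con.
have szr := leq_trans szS pr.
have [s Es] := sig_signotope vS' (sig_con t0 tr szr vS sS gt).
have le' : #|plus_set s| <= p.
  rewrite -size_plus_seqs; apply: leq_trans szS; rewrite -(size_map (con t) (plus_seqs v)).
  by apply: uniq_leq_size (plus_seqs_uniq s) _ => x; rewrite Es.
exists (SignotopeLe le'), t; split=> //= [y vy|x].
  by rewrite !Es; apply: con_uncrossed vy.
apply/idP/mapP => [xS|[a]].
  exists (con t x); first by rewrite Es map_f.
  by rewrite (minus_at_conK t0 tr vS gt).
by rewrite Es => /mapP[c cS ->] ->; rewrite (minus_at_conK t0 tr vS gt).
Qed.

(** The thresholds [t] and [q] may differ, but [uncrossed] and [minus_at] pass to subfamilies, so
    the smaller family can be doubled or merged at the threshold of the larger one. *)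
Lemma dup_rel_sub s u v w : dup_rel s v -> dup_rel u w ->
  (plus_set s \subset plus_set u) = (plus_set v \subset plus_set w).
Proof.
move=> [t [t0 tr gt Et]] [q [q0 qr gq Eq]].
have vS := @valid_plus_seqs n r s; have vU := @valid_plus_seqs n r u.
apply/idP/idP => /plus_set_sub sub; apply/plus_set_sub => x.
  rewrite Et => /mapP[a aS ->]; rewrite Eq.
  have gq' : uncrossed n r q (plus_seqs s).
    by move=> y vy; apply: contra (gq y vy) => /andP[/sub-> /sub->].
  have sS : sig n r (plus_seqs s) by apply/signotopeP/valP.
  by rewrite (uncrossed_dup_eq sS gt gq' t0 tr q0 qr (vS _ aS) aS) map_f ?sub.
move=> xS; have xS' : dup t x \in plus_seqs v by rewrite Et map_f.
have /mapP[b bU Eb] : dup t x \in map (dup q) (plus_seqs u) by rewrite -Eq sub.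
have sS : sig n.+1 r.+1 (plus_seqs v) by apply/signotopeP/valP.
have st : minus_at n.+1 r.+1 t (plus_seqs v).
  by move=> y vy; rewrite Et; apply: (dup_minus_at t0 tr vS).
have sq : minus_at n.+1 r.+1 q (plus_seqs v).
  by move=> y vy; apply: contra (dup_minus_at q0 qr vU vy) => /sub; rewrite Eq.
have vx : valid n.+1 r.+1 (dup t x) by apply: valid_dup => //; apply: vS.
(* The set [dup t x = dup q b] merges to [x] at [t] and to [b] at [q], so [x = b]. *)
have := minus_at_con_eq sS st sq tr qr vx xS'.
by rewrite (dupK t0 tr (vS _ xS)) Eb (dupK q0 qr (vU _ bU)) => ->.
Qed.

Lemma dup_rel_card s v : dup_rel s v -> #|plus_set v| = #|plus_set s|.
Proof.
move=> [t [t0 tr gt Et]]; rewrite -!size_plus_seqs -(size_map (dup t) (plus_seqs s)).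
apply: perm_size; apply: uniq_perm Et; first exact: plus_seqs_uniq.
rewrite map_inj_in_uniq ?plus_seqs_uniq // => a b /valid_plus_seqs va /valid_plus_seqs vb E.
by rewrite -(dupK t0 tr va) E (dupK t0 tr vb).
Qed.

Lemma dup_rel_step s u v w : dup_rel s v -> dup_rel u w ->
  single_step s u = single_step v w.
Proof.
move=> sv uw; rewrite /single_step (dup_rel_sub sv uw).
by rewrite (dup_rel_card sv) (dup_rel_card uw).
Qed.

Lemma signotope_le_eq m k (v w : signotope_le p m k) :
  plus_set v \subset plus_set w -> plus_set w \subset plus_set v -> v = w.
Proof.
move=> vw wv; do 2!apply: val_inj; apply: plus_set_inj.
by apply/eqP; rewrite eqEsubset vw wv.
Qed.

(** The common partner contains itself, so by [dup_rel_sub] the families [s] and [u] contain each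
    other. *)
Lemma dup_rel_inj s u v : dup_rel s v -> dup_rel u v -> s = u.
Proof.
by move=> ss us; apply: signotope_le_eq; rewrite (dup_rel_sub ss us, dup_rel_sub us ss).
Qed.

Lemma dup_rel_fun s v w : dup_rel s v -> dup_rel s w -> v = w.
Proof.
by move=> ss su; apply: signotope_le_eq; rewrite -(dup_rel_sub ss su, dup_rel_sub su ss).
Qed.

End DupRel.

(** * Iteration over the rank and passage to the higher Bruhat order *)

Definition step_iso p n r n' r' : Prop :=
  exists (f : signotope_le p n r -> signotope_le p n' r') g,
    [/\ cancel f g, cancel g f
      & forall s u : signotope_le p n r, single_step s u = single_step (f s) (f u)].

Lemma step_iso_refl p n r : step_iso p n r n r.
Proof. by exists id, id. Qed.

Lemma step_iso_sym p n r n' r' : step_iso p n r n' r' -> step_iso p n' r' n r.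
Proof. by move=> [f [g [fg gf E]]]; exists g, f; split=> // s u; rewrite E !gf. Qed.

Lemma step_iso_trans p n r n1 r1 n2 r2 :
  step_iso p n r n1 r1 -> step_iso p n1 r1 n2 r2 -> step_iso p n r n2 r2.
Proof.
move=> [f [g [fg gf E]]] [f' [g' [fg' gf' E']]]; exists (f' \o f), (g \o g').
by split=> [||s u]; [exact: can_comp|exact: can_comp|rewrite E E'].
Qed.

Lemma step_isoS p n r : 0 < r -> p <= r -> step_iso p n r n.+1 r.+1.
Proof.
move=> r0 pr.
have [f Hf] := fin_all_exists (dup_relT (n := n) r0 pr).
have [g Hg] := fin_all_exists (dup_rel_onto (n := n) r0 pr).
exists f, g; split=> [s|s'|s u]; last exact: dup_rel_step.
  exact: dup_rel_inj (Hg _) (Hf s).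
exact: dup_rel_fun (Hf _) (Hg s').
Qed.

Lemma step_iso_add p d r e : 0 < r -> p <= r -> step_iso p (r + d) r (r + e + d) (r + e).
Proof.
move=> r0 pr; elim: e => [|e IH]; first by rewrite addn0; apply: step_iso_refl.
by apply: step_iso_trans IH _; rewrite addnS addSn; apply: step_isoS; lia.
Qed.

(** Steps only add positive sets, so a chain that ends with at most [p] of them never had more. *)
Lemma bruhat_le_connect p n r (s u : signotope_le p n r) :
  bruhat_le s u = connect (fun v w : signotope_le p n r => single_step v w) s u.
Proof.
apply/idP/idP; last first.
  case/connectP=> q pq ->; apply/connectP; exists (map val q); last by rewrite last_map.
  by rewrite path_map.
case/connectP=> q; elim: q s => [|v q IH] s /=.
  by move=> _ /val_inj->; apply: connect0.
case/andP=> sv pq uq.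
have le_path (w : signotope n r) l : path (fun a b : signotope n r => single_step a b) w l ->
    #|plus_set w| <= #|plus_set (last w l)|.
  elim: l w => [|x l IHl] w //= /andP[/andP[_ /eqP E] /IHl].
  by apply: leq_trans; rewrite E.
have lev : #|plus_set v| <= p.
  by apply: leq_trans (le_path _ _ pq) _; rewrite -uq; apply: (valP u).
apply: connect_trans (connect1 _) (IH (SignotopeLe lev) pq uq).
exact: sv.
Qed.

Lemma connect_homo (T T' : finType) (e : rel T) (e' : rel T') (f : T -> T') :
  (forall s u, e s u -> e' (f s) (f u)) ->
  forall s u, connect e s u -> connect e' (f s) (f u).
Proof.
move=> H s u /connectP[q pq ->]; apply/connectP; exists (map f q); last by rewrite last_map.
by rewrite path_map; apply: sub_path pq.
Qed.

Theorem theorem4 (n n' r r' d p : nat)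
    (hr : 0 < r) (hr' : 0 < r')
    (hn : n = r + d) (hn' : n' = r' + d)
    (hp : p <= minn r r') :
  exists Phi : signotope_le p n r -> signotope_le p n' r',
    bijective Phi /\
    forall s t : signotope_le p n r,
      bruhat_le s t <-> bruhat_le (Phi s) (Phi t).
Proof.
have [pr pr'] : p <= r /\ p <= r' by lia.
have [f [g [fg gf E]]] : step_iso p n r n' r'.
  (* The iteration climbs from the smaller of the two ranks. *)
  rewrite hn hn'; case: (leqP r r') => [le|/ltnW le].
    by rewrite -(subnKC le); apply: step_iso_add.
  by apply: step_iso_sym; rewrite -(subnKC le); apply: step_iso_add.
exists f; split; first by exists g.
move=> s t; rewrite !bruhat_le_connect; split.
  by apply: connect_homo => v w; rewrite E.
(* Reflection: the inverse [g] carries a chain from [f s] to [f t] back. *)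
rewrite -{2}(fg s) -{2}(fg t).
by apply: connect_homo => v w; rewrite E !gf.
Qed.
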